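(* Let $p>0$. There is a constant $C=C(p)>0$ such that if $\mathbb{P}$ is a product probability measure on a product $\mathcal{P}=\mathcal{P}_1\times\cdots\times\mathcal{P}_n$ in which each factor $\mathcal{P}_i$ is a poset with a greatest element whose probability is at least $p$, then for any two upsets $A$ and $B$ in $\mathcal{P}$ we have $$\mathbb{P}(A\cap B)\ge(\mathbb{P}(A)\mathbb{P}(B))^C.$$
   Context: The product of posets $\mathcal{P}_1,\ldots,\mathcal{P}_n$ is the poset $\mathcal{P}_1\times\cdots\times\mathcal{P}_n$ with $\mathbf{x}\preccurlyeq\mathbf{y}$ if and only if $x_i\preccurlyeq y_i$ for $i=1,\ldots,n$. A greatest element of a poset is an element $y$ with $x\preccurlyeq y$ for all $x$; ''its probability'' is its probability under the corresponding marginal measure on $\mathcal{P}_i$. An upset in a poset is a subset $\mathcal{U}$ such that $x\in\mathcal{U}$ and $x\preccurlyeq y$ imply $y\in\mathcal{U}$ (upsets considered here are events, i.e. measurable). *)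

(* Defs.v *)
From HB Require Import structures.
From mathcomp Require Import all_boot all_order all_algebra.
From mathcomp Require Import all_classical all_reals all_analysis.

Set Implicit Arguments.
Unset Strict Implicit.
Unset Printing Implicit Defensive.

Import Order.TTheory.

Local Open Scope classical_set_scope.

(* The poset T with event sigma-algebra <<s G>>; every sigma-algebra F on T
   arises, with G := F. The alias is needed because HB rejects a join of
   Measurable and Order.POrder once the library's ordered topological
   structures are loaded. *)
Definition event_poset (o : Order.disp_t) (T : tPOrderType o)
  (G : set (set T)) : Type := T.

Section event_poset_instances.
Context (o : Order.disp_t) (T : tPOrderType o).
Variable G : set (set T).

HB.instance Definition _ := Order.TPOrder.copy (event_poset G) T.
HB.instance Definition _ := isPointed.Build (event_poset G) (\top : T)%O.
HB.instance Definition _ := @isMeasurable.Build (sigma_display G)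
  (event_poset G) <<s G >> (@sigma_algebra0 _ setT G)
  (@sigma_algebraC (event_poset G) G) (@sigma_algebra_bigcup _ setT G).

End event_poset_instances.

Definition prod_poset (n : nat) (o : 'I_n -> Order.disp_t)
    (T : forall i : 'I_n, tPOrderType (o i))
    (G : forall i : 'I_n, set (set (T i))) : Type :=
  forall i : 'I_n, event_poset (G i).

Definition prod_poset_display (n : nat) :
  ('I_n -> Order.disp_t) -> Order.disp_t.
Proof. exact: (fun=> Order.default_display). Qed.

Section prod_poset_instances.
Context (n : nat) (o : 'I_n -> Order.disp_t).
Variable T : forall i : 'I_n, tPOrderType (o i).
Variable G : forall i : 'I_n, set (set (T i)).
Arguments G : clear implicits.

HB.instance Definition _ :=
  Pointed.copy (prod_poset G) (forall i : 'I_n, event_poset (G i)).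

Definition cylinders : set (set (prod_poset G)) :=
  \bigcup_(i in [set: 'I_n])
    preimage_set_system setT (fun x : prod_poset G => x i) measurable.

HB.instance Definition _ := @isMeasurable.Build (sigma_display cylinders)
  (prod_poset G) <<s cylinders >> (@sigma_algebra0 _ setT cylinders)
  (@sigma_algebraC _ cylinders) (@sigma_algebra_bigcup _ setT cylinders).

Definition prod_poset_le (x y : prod_poset G) : bool :=
  [forall i : 'I_n, (x i <= y i)%O].

Let prod_poset_le_refl : reflexive prod_poset_le.
Proof. by move=> x; apply/forallP. Qed.

Let prod_poset_le_anti : antisymmetric prod_poset_le.
Proof.
move=> x y /andP[/forallP xy /forallP yx].
by apply: functional_extensionality_dep => i; apply: le_anti; rewrite xy yx.
Qed.

Let prod_poset_le_trans : transitive prod_poset_le.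
Proof.
move=> y x z /forallP xy /forallP yz; apply/forallP => i.
exact: le_trans (xy i) (yz i).
Qed.

HB.instance Definition _ := Order.Le_isPOrder.Build (prod_poset_display o)
  (prod_poset G) prod_poset_le_refl prod_poset_le_anti prod_poset_le_trans.

End prod_poset_instances.

Definition upset (o : Order.disp_t) (T : porderType o) (U : set T) : Prop :=
  forall x y : T, U x -> (x <= y)%O -> U y.

(* Measurable boxes generate the product sigma-algebra and are stable under
   intersection, so this determines P: it is the product of the mu i, and the
   mu i are its marginals. *)
Definition is_product_probability (R : realType) (n : nat)
    (o : 'I_n -> Order.disp_t) (T : forall i : 'I_n, tPOrderType (o i))
    (G : forall i : 'I_n, set (set (T i)))
    (mu : forall i : 'I_n, probability (event_poset (G i)) R)
    (P : probability (prod_poset G) R) : Prop :=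
  forall E : forall i : 'I_n, set (event_poset (G i)),
  (forall i, measurable (E i)) ->
  P [set x : prod_poset G | forall i, E i (x i)] =
  (\prod_(i < n) mu i (E i))%E.

(* Main.v *)
Require Import Defs.
From mathcomp Require Import all_boot all_order all_algebra.
From mathcomp Require Import all_classical all_reals all_analysis.
From mathcomp Require Import measurable_realfun ring lra.

(** Write N for the exponent C, an integer. The inequality is a case of a
    functional one: for increasing f and g with values in [0, 1],
      (E f * E g)^N <= E (f g)^N,
    applied to the indicators of A and B. In this form it tensorizes. Averaging
    f and g over one coordinate keeps them increasing, and the inequality in
    that coordinate alone, used pointwise in the others, shows that replacing
    f and g by their averages can only decrease E (f g)^N, while E f and E g do
    not change. Once all coordinates have been averaged out, f and g are the
    constants E f and E g, so E (f g)^N has become (E f * E g)^N.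

    There remains one factor, where increasing means only that f and g are
    maximal at a point t0 of mass at least p ([atom_correlation]). Scale so that
    f t0 = g t0 = 1. Then f g >= f + g - 1, and Jensen's inequality for y ^ N
    off t0 gives E (f g)^N >= p + (1 - p) h^N, where p + (1 - p) h is the larger
    of E f + E g - 1 and p. Since E f * E g <= ((E f + E g) / 2)^2, this reduces
    to an inequality between two functions of h that agree at h = 1
    ([atom_scalar_ineq]). For E f, E g near 1 the two sides agree to first
    order; the second order term of the left side exceeds that of the right
    by a factor that tends to 1 / (1 - p) > 1 as N grows, thanks to the atom.

    Averaging over coordinate i is done in place, by overwriting the i-th
    coordinate of a point of the product with an independent sample of law mu i
    ([resample]). That this preserves P follows from uniqueness of a measure
    given its values on boxes. *)

Import Order.TTheory GRing.Theory Num.Theory.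
Import numFieldNormedType.Exports.

Local Open Scope classical_set_scope.
Local Open Scope ring_scope.
Local Open Scope ereal_scope.

(** * Scalar inequalities *)

(** The convex function y ^ (M + 1) lies above its tangent at h; integrated, this
    is Jensen's inequality. *)
Lemma ler_tangent_exprS (R : realDomainType) (h y : R) (M : nat) :
  (0 <= h -> 0 <= y ->
   h ^+ M.+1 + M.+1%:R * h ^+ M * (y - h) <= y ^+ M.+1)%R.
Proof.
move=> h0 y0; elim: M => [|M IHM]; first by rewrite !expr1 expr0; lra.
have sq : (0 <= M.+1%:R * (h ^+ M * (y - h) ^+ 2))%R.
  by apply: mulr_ge0 => //; apply: mulr_ge0; [exact: exprn_ge0|exact: sqr_ge0].
have := ler_wpM2l y0 IHM.
rewrite (exprS y M.+1) (exprS h M.+1) (exprS h M) -(natr1 M.+1).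
by move: sq; set a := M.+1%:R; set b := (h ^+ M)%R; set c := (y ^+ M.+1)%R; lra.
Qed.

Lemma expr_onem_mulD1_le1 (R : realDomainType) (a : R) (M : nat) :
  (0 <= a <= 1 -> (1 - a) ^+ M * (1 + M%:R * a) <= 1)%R.
Proof.
move=> /andP[a0 a1]; elim: M => [|M IHM]; first by rewrite expr0; lra.
apply: le_trans IHM; rewrite exprSr -mulrA ler_wpM2l ?exprn_ge0 ?subr_ge0//.
have : (0 <= M%:R :> R)%R by [].
by rewrite -natr1; set m := M%:R; nra.
Qed.

(** The comparison of derivatives behind [atom_scalar_ineq]. With
    w = p + (1 - p) h, both h <= w (1 - p (1 - h)) and w <= ((1 + w) / 2)^2
    hold, so h^M <= ((1 + w) / 2)^(2 M) (1 - p (1 - h))^M. As M p >= 1, the last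
    factor is at most 1 / (2 - h), hence at most (1 + h) / 2 <= (1 + w) / 2. *)
Lemma atom_derivative_le (R : realFieldType) (p h : R) (M : nat) :
  (0 < p < 1 -> 1 <= M%:R * p -> 0 <= h <= 1 ->
   h ^+ M <= ((1 + (p + (1 - p) * h)) / 2) ^+ M.*2.+1)%R.
Proof.
move=> /andP[p0 p1] Mp /andP[h0 h1].
set w := (p + (1 - p) * h)%R; set v := ((1 + w) / 2)%R.
set a := (p * (1 - h))%R.
have w0 : (0 <= w)%R by rewrite /w; nra.
have a01 : (0 <= a <= 1)%R by rewrite /a; nra.
have v0 : (0 <= v)%R by rewrite /v; lra.
have hw : (h <= w * (1 - a))%R.
  rewrite -subr_ge0; have -> : (w * (1 - a) - h = p * (1 - p) * (1 - h) ^+ 2)%R.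
    by rewrite /w /a; ring.
  by rewrite mulr_ge0 ?sqr_ge0// mulr_ge0//; lra.
have wv : (w <= v ^+ 2)%R.
  rewrite -subr_ge0; have -> : (v ^+ 2 - w = ((1 - w) / 2) ^+ 2)%R.
    by rewrite /v; field.
  exact: sqr_ge0.
have hv : (1 <= (1 + M%:R * a) * v)%R.
  have ha : (1 - h <= M%:R * a)%R by rewrite /a mulrA ler_peMl// subr_ge0.
  have hv : ((1 + h) / 2 <= v)%R by rewrite /v /w; nra.
  apply: (@le_trans _ _ ((2 - h) * ((1 + h) / 2)))%R; first by nra.
  by apply: ler_pM => //; lra.
rewrite exprSr -mul2n exprM.
apply: (@le_trans _ _ (w ^+ M * v)%R); last first.
  by rewrite ler_wpM2r// lerXn2r// nnegrE sqr_ge0.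
apply: (le_trans (lerXn2r M _ _ hw)); rewrite ?nnegrE//.
  exact: le_trans hw.
rewrite exprMn ler_wpM2l ?exprn_ge0//.
have := expr_onem_mulD1_le1 R a M a01.
have : (0 <= (1 - a) ^+ M)%R by rewrite exprn_ge0//; lra.
by set b := ((1 - a) ^+ M)%R; nra.
Qed.

(** Both sides equal 1 at h = 1, and their difference is nonincreasing on
    [0, 1]; at h = 0 the inequality says ((1 + p) / 2)^(2 (M + 1)) <= p. *)
Lemma atom_scalar_ineq (R : realType) (p h : R) (M : nat) :
  (0 < p < 1 -> 1 <= M%:R * p -> 0 <= h <= 1 ->
   ((1 + (p + (1 - p) * h)) / 2) ^+ M.*2.+2 <= p + (1 - p) * h ^+ M.+1)%R.
Proof.
move=> p01 Mp /[dup] h01 /andP[h0 h1].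
pose v : {poly R} := (((1 + p) / 2)%:P + ((1 - p) / 2) *: 'X)%R.
pose F : {poly R} := (p%:P + (1 - p) *: 'X^(M.+1) - v ^+ M.*2.+2)%R.
have vE (x : R) : (v.[x] = (1 + (p + (1 - p) * x)) / 2)%R.
  by rewrite /v hornerD hornerZ hornerX hornerC; field.
have FE (x : R) :
    (F.[x] = p + (1 - p) * x ^+ M.+1 - (v.[x]) ^+ M.*2.+2)%R.
  by rewrite /F hornerD hornerN hornerD hornerZ hornerXn hornerC horner_exp.
have dFE (x : R) :
    (F^`().[x] = (1 - p) * M.+1%:R * (x ^+ M - v.[x] ^+ M.*2.+1))%R.
  rewrite /F derivB derivD derivC derivZ derivXn deriv_exp add0r.
  rewrite hornerD hornerN hornerZ !hornerMn hornerXn hornerM horner_exp/=.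
  have -> : (v^`() = ((1 - p) / 2)%:P)%R.
    by rewrite /v derivD derivC add0r derivZ derivX alg_polyC.
  have -> : (M.*2.+2 = 2 * M.+1)%N by rewrite -mul2n mulnS.
  rewrite hornerC -(mulr_natl (x ^+ M)) -[X in (_ - X)%R]mulr_natl natrM.
  set a := (x ^+ M)%R; set b := (_ ^+ _)%R; set c := (M.+1%:R)%R.
  by field.
suff : (F.[1] <= F.[h])%R.
  rewrite !FE !vE; have -> : (1 + (p + (1 - p) * 1) = 2 :> R)%R by ring.
  by rewrite divff// !expr1n mulr1; lra.
apply: (@ler0_derive1_le_cc _ (horner F) 0 1)%R.
- by move=> x _; exact: derivable_horner.
- move=> x; rewrite in_itv/= => /andP[x0 x1].
  rewrite -derive.derivE dFE vE.
  have := atom_derivative_le R p x M p01 Mp.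
  rewrite (ltW x0) (ltW x1) => /(_ erefl) hx.
  rewrite mulr_ge0_le0 ?subr_le0// mulr_ge0//; lra.
- by apply: continuous_subspaceT; exact: continuous_horner.
- by rewrite in_itv/= lexx ler01.
- by rewrite in_itv/= h0.
- exact: h1.
Qed.

(** * One factor *)

Lemma probability_bounded_integrable (d : measure_display)
    (T : measurableType d) (R : realType) (mu : probability T R)
    (f : T -> R) (c : R) :
  measurable_fun setT f -> (forall t, 0 <= f t <= c)%R ->
  mu.-integrable setT (EFin \o f).
Proof.
move=> mf fc; apply: measurable_bounded_integrable => //.
  by apply: (@le_lt_trans _ _ 1); rewrite ?ltry// probability_le1.
exists c; split; first exact: num_real.
move=> x cx t _ /=; have /andP[f0 fc'] := fc t.
by rewrite ger0_norm// (le_trans fc')// ltW.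
Qed.

Lemma Rintegral_probability_cst (d : measure_display)
    (T : measurableType d) (R : realType) (mu : probability T R) (c : R) :
  (\int[mu]_t c = c)%R.
Proof.
rewrite Rintegral_cst// -[RHS]mulr1; congr (_ * _)%R.
exact: (congr1 fine (probability_setT mu)).
Qed.

Lemma measurable_expM (d : measure_display) (T : measurableType d)
    (R : realType) (N : nat) (f g : T -> R) :
  measurable_fun setT f -> measurable_fun setT g ->
  measurable_fun setT (fun t => ((f t * g t) ^+ N)%R).
Proof. by move=> mf mg; apply: measurable_funX; exact: measurable_funM. Qed.

(** Jensen's inequality with the atom set apart: (f g)^(M + 1) lies above an
    affine function of f, of g and of the indicator of t0, made from the tangent
    at h, and integrating that function gives p + (1 - p) h^(M + 1). *)
Lemma atom_correlation_normalized (d : measure_display) (T : measurableType d)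
    (R : realType) (mu : probability T R) (t0 : T) (p : R) (M : nat)
    (f g : T -> R) :
  (0 < p < 1)%R -> (1 <= M%:R * p)%R ->
  measurable [set t0] -> p%:E <= mu [set t0] ->
  measurable_fun setT f -> measurable_fun setT g ->
  (forall t, 0 <= f t <= 1)%R -> (forall t, 0 <= g t <= 1)%R ->
  f t0 = 1%R -> g t0 = 1%R ->
  ((\int[mu]_t f t * \int[mu]_t g t) ^+ M.+1 <=
   \int[mu]_t (f t * g t) ^+ M.+1)%R.
Proof.
move=> p01 Mp mt0 pmu mf mg f01 g01 ft0 gt0.
have /andP[p0 p1] := p01.
have If := probability_bounded_integrable _ _ _ mu f 1 mf f01.
have Ig := probability_bounded_integrable _ _ _ mu g 1 mg g01.
have mean01 (u : T -> R) : measurable_fun setT u ->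
    (forall t, 0 <= u t <= 1)%R -> (0 <= \int[mu]_t u t <= 1)%R.
  move=> mu_ u01; rewrite Rintegral_ge0/=; last first.
    by move=> t _; case/andP: (u01 t).
  rewrite -[leRHS](Rintegral_probability_cst _ _ _ mu).
  apply: le_Rintegral => //.
  - exact: probability_bounded_integrable u01.
  - exact: finite_measure_integrable_cst.
  by move=> t _; case/andP: (u01 t).
have /andP[m0 m1] := mean01 _ mf f01.
have /andP[n0 n1] := mean01 _ mg g01.
set m := (\int[mu]_t f t)%R in m0 m1 *; set n := (\int[mu]_t g t)%R in n0 n1 *.
(* For an atom of mass exactly p, h bounds the mean of f g off the atom from
   below, trivially so when m + n - 1 < p. *)
pose h := Num.max 0%R ((m + n - 1 - p) / (1 - p))%R.
pose w := (p + (1 - p) * h)%R.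
have h0 : (0 <= h)%R by rewrite le_max lexx.
have q0 : (0 < 1 - p)%R by rewrite subr_gt0.
have h1 : (h <= 1)%R by rewrite ge_max ler01 ler_pdivrMr// mul1r; lra.
have mnw : (m + n - 1 <= w)%R.
  rewrite -lerBlDl mulrC -ler_pdivrMr//.
  by rewrite le_max lexx orbT.
have M0 : (0 < M)%N by case: (M) Mp => //; rewrite mul0r ler10.
have hw : h = 0%R \/ (m + n - 1 = w)%R.
  rewrite /w /h; case: leP => _; last by left.
  by right; rewrite mulrC divfK ?gt_eqF//; ring.
pose a := (h ^+ M.+1)%R; pose b := (M.+1%:R * h ^+ M)%R.
(* c is the gap between y ^ M.+1 and its tangent at y = 1, the value of f g at
   the atom. *)
pose c := (1 - a - b * (1 - h))%R.
have b0 : (0 <= b)%R by rewrite mulr_ge0// exprn_ge0.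
have c0 : (0 <= c)%R.
  have := ler_tangent_exprS R h 1 M h0 ler01; rewrite expr1n -/a -/b /c; lra.
(* If h = 0 then the slope b vanishes, as M > 0, so that m + n - 1 may be
   replaced by w in both cases. *)
have bw : (b * (m + n - 1) = b * w)%R.
  by case: hw => [hz|->//]; rewrite /b hz expr0n gtn_eqF// mulr0 !mul0r.
have Ll t : (a - b - b * h + b * f t + b * g t + c * \1_[set t0] t <=
     (f t * g t) ^+ M.+1)%R.
  have [->|tt0] := eqVneq t t0.
    by rewrite ft0 gt0 indicE mem_set// /c !mulr1 expr1n; lra.
  rewrite indicE memNset ?mulr0 ?addr0; last exact/eqP.
  have /andP[ft ft1] := f01 t; have /andP[gt gt1] := g01 t.
  apply: le_trans (ler_tangent_exprS R h _ M h0 (mulr_ge0 ft gt)).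
  rewrite -/a -/b.
  have : (0 <= b * ((1 - f t) * (1 - g t)))%R.
    by apply: mulr_ge0 => //; apply: mulr_ge0; rewrite subr_ge0.
  by set F := f t; set G := g t; lra.
have := atom_scalar_ineq R p h M p01 Mp; rewrite h0 h1 => /(_ erefl).
rewrite -/w -/a => scal.
apply: (@le_trans _ _ (p + (1 - p) * a)%R).
  apply: le_trans scal.
  have -> : (M.*2.+2 = 2 * M.+1)%N by rewrite -mul2n mulnS.
  have mn : (m * n <= ((1 + w) / 2) ^+ 2)%R.
    apply: (@le_trans _ _ (((m + n) / 2) ^+ 2)%R).
      rewrite -subr_ge0.
      have -> : (((m + n) / 2) ^+ 2 - m * n = ((m - n) / 2) ^+ 2)%R by field.
      exact: sqr_ge0.
    by rewrite lerXn2r// ?nnegrE; lra.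
  rewrite exprM lerXn2r// nnegrE; [exact: mulr_ge0|exact: sqr_ge0].
have It0 : mu.-integrable setT (EFin \o (\1_[set t0] : T -> R)).
  apply: (probability_bounded_integrable _ _ _ mu _ 1) => // t.
  by rewrite indicE; case: (_ \in _); rewrite /= ?lexx ?ler01.
have ID (u v : T -> R) : mu.-integrable setT (EFin \o u) ->
    mu.-integrable setT (EFin \o v) ->
    mu.-integrable setT (EFin \o (fun t => u t + v t)%R).
  by move=> Iu Iv; exact: (integrableD measurableT Iu Iv).
have IZ (k : R) (u : T -> R) : mu.-integrable setT (EFin \o u) ->
    mu.-integrable setT (EFin \o (fun t => k * u t)%R).
  by move=> Iu; exact: (integrableZl measurableT k Iu).
have IH : mu.-integrable setT (EFin \o (fun t => (f t * g t) ^+ M.+1)%R).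
  apply: (probability_bounded_integrable _ _ _ mu _ 1).
    exact: measurable_expM.
  move=> t; have /andP[ft ft1] := f01 t; have /andP[gt gt1] := g01 t.
  by rewrite exprn_ge0 ?exprn_ile1 ?mulr_ge0 ?mulr_ile1.
have Ik (k : R) : mu.-integrable setT (EFin \o (fun=> k)).
  exact: finite_measure_integrable_cst.
have pe : (p <= \int[mu]_t \1_[set t0] t)%R.
  rewrite /Rintegral integral_indic// setIT -lee_fin fineK//.
  exact: fin_num_measure.
have := le_Rintegral measurableT _ IH (fun t _ => Ll t).
rewrite !RintegralD ?RintegralZl ?Rintegral_probability_cst//; try by auto 8.

move=> /(_ ltac:(by auto 8)); apply: le_trans; rewrite -/m -/n.
set e := (\int[mu]_t _)%R in pe *.
have : (0 <= c * (e - p))%R by rewrite mulr_ge0// subr_ge0.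
have -> : (p + (1 - p) * a = a + b * (w - h) + c * p)%R.
  by rewrite /c /w; ring.
by lra.
Qed.

(** Both sides are homogeneous of degree M + 1 in f and in g, so f t0 = g t0 = 1
    may be assumed unless one of f and g vanishes. *)
Lemma atom_correlation (d : measure_display) (T : measurableType d)
    (R : realType) (mu : probability T R) (t0 : T) (p : R) (M : nat)
    (f g : T -> R) :
  (0 < p < 1)%R -> (1 <= M%:R * p)%R ->
  measurable [set t0] -> p%:E <= mu [set t0] ->
  measurable_fun setT f -> measurable_fun setT g ->
  (forall t, 0 <= f t <= f t0)%R -> (forall t, 0 <= g t <= g t0)%R ->
  ((\int[mu]_t f t * \int[mu]_t g t) ^+ M.+1 <=
   \int[mu]_t (f t * g t) ^+ M.+1)%R.
Proof.
move=> p01 Mp mt0 pmu mf mg f0 g0.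
have zero (u : T -> R) : (forall t, 0 <= u t <= u t0)%R -> u t0 = 0%R ->
    (\int[mu]_t u t = 0)%R.
  move=> u0 ut0; rewrite -(Rintegral_probability_cst _ _ _ mu 0).
  apply: eq_Rintegral => t _; apply/eqP; rewrite eq_le.
  by have := u0 t; rewrite ut0 andbC.
have H0 : (0 <= \int[mu]_t (f t * g t) ^+ M.+1)%R.
  apply: Rintegral_ge0 => t _; rewrite exprn_ge0// mulr_ge0//.
    by case/andP: (f0 t).
  by case/andP: (g0 t).
have [/(zero _ f0) ->|ft0] := eqVneq (f t0) 0%R; first by rewrite mul0r expr0n.
have [/(zero _ g0) ->|gt0] := eqVneq (g t0) 0%R; first by rewrite mulr0 expr0n.
have {}ft0 : (0 < f t0)%R by rewrite lt_def ft0; case/andP: (f0 t0).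
have {}gt0 : (0 < g t0)%R by rewrite lt_def gt0; case/andP: (g0 t0).
pose k := (f t0)^-1%R; pose l := (g t0)^-1%R.
have k0 : (0 < k)%R by rewrite invr_gt0.
have l0 : (0 < l)%R by rewrite invr_gt0.
have norm (u : T -> R) : (0 < u t0)%R -> (forall t, 0 <= u t <= u t0)%R ->
    forall t, (0 <= (u t0)^-1 * u t <= 1)%R.
  move=> ut0 u0 t; have /andP[ut ut1] := u0 t.
  by rewrite mulr_ge0 ?invr_ge0 ?(ltW ut0)//= mulrC ler_pdivrMr// mul1r.
have := @atom_correlation_normalized _ _ _ mu t0 p M (fun t => k * f t)%R
  (fun t => l * g t)%R p01 Mp mt0 pmu.
rewrite /k /l !mulVf ?gt_eqF// -/k -/l.
move=> /(_ (measurable_funM (measurable_cst _) mf)).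
move=> /(_ (measurable_funM (measurable_cst _) mg)).
move=> /(_ (norm _ ft0 f0) (norm _ gt0 g0) erefl erefl).
have If := probability_bounded_integrable _ _ _ mu f _ mf f0.
have Ig := probability_bounded_integrable _ _ _ mu g _ mg g0.
have IH : mu.-integrable setT (EFin \o (fun t => (f t * g t) ^+ M.+1)%R).
  apply: (probability_bounded_integrable _ _ _ mu _ ((f t0 * g t0) ^+ M.+1)%R).
    exact: measurable_expM.
  move=> t; have /andP[ft ft1] := f0 t; have /andP[gt gt1] := g0 t.
  apply/andP; split; first by rewrite exprn_ge0// mulr_ge0.
  apply: lerXn2r; rewrite ?nnegrE; [exact: mulr_ge0| |exact: ler_pM].
  by apply: mulr_ge0; exact: ltW.
rewrite !RintegralZl//.
under [X in (_ <= X)%R -> _]eq_Rintegral do rewrite mulrACA exprMn.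
rewrite RintegralZl// mulrACA [X in (X <= _)%R -> _]exprMn.
by rewrite ler_pM2l// exprn_gt0// mulr_gt0.
Qed.

(** * Resampling one coordinate of a product *)

Section resampling.
Context (R : realType) (n : nat) (o : 'I_n -> Order.disp_t).
Variable T : forall i : 'I_n, tPOrderType (o i).
Variable G : forall i : 'I_n, set (set (T i)).
Arguments G : clear implicits.
Variable mu : forall i : 'I_n, probability (event_poset (G i)) R.
Variable P : probability (prod_poset G) R.
Hypothesis muP : is_product_probability mu P.

Definition resample (i : 'I_n) (z : prod_poset G * event_poset (G i)) :
    prod_poset G :=
  dfwith z.1 i z.2.

Definition box (E : forall i : 'I_n, set (event_poset (G i))) :
    set (prod_poset G) :=
  [set x | forall i, E i (x i)].

Lemma probability_box (E : forall i : 'I_n, set (event_poset (G i))) :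
  (forall i, measurable (E i)) -> P (box E) = \prod_(i < n) mu i (E i).
Proof. exact: muP. Qed.

Lemma measurable_coordinate (i : 'I_n) :
  measurable_fun setT (fun x : prod_poset G => x i).
Proof.
move=> _ A mA; apply: sub_sigma_algebra; exists i => //.
by exists A.
Qed.

Lemma measurable_box (E : forall i : 'I_n, set (event_poset (G i))) :
  (forall i, measurable (E i)) -> measurable (box E).
Proof.
move=> mE; have -> : box E = \bigcap_(i in [set: 'I_n])
    ([set: prod_poset G] `&` (fun x : prod_poset G => x i) @^-1` E i).
  apply/seteqP; split=> [x Ex i _|x Ex i]; first by split=> //; exact: Ex.
  by have [] := Ex i I.
apply: fin_bigcap_measurable => // i _.
exact: measurable_coordinate.
Qed.

Lemma measurable_resample (i : 'I_n) : measurable_fun setT (resample i).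
Proof.
apply: (measurability (@cylinders n o T G)) => //.
move=> _ [_ [j _ [A mA <-]] <-]; rewrite !setTI.
have [ij|ij] := eqVneq i j.
  subst j.
  rewrite [X in measurable X](_ : _ = snd @^-1` A).
    by rewrite -[X in measurable X]setTI; exact: measurable_snd.
  by apply/seteqP; split=> z /=; rewrite /resample dfwithin.
rewrite [X in measurable X](_ : _ =
    (fun z : prod_poset G * event_poset (G i) => z.1 j) @^-1` A).
  rewrite -[X in measurable X]setTI.
  apply: (measurableT_comp (measurable_coordinate j) measurable_fst) => //.
by apply/seteqP; split=> z /=; rewrite /resample dfwithout.
Qed.


Lemma measurable_generated_by_boxes :
  @measurable _ (prod_poset G) =
  <<s [set A | exists2 E : forall i : 'I_n, set (event_poset (G i)),
    (forall i, measurable (E i)) & A = box E] >>.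
Proof.
apply/seteqP; split.
  apply: sub_sigma_algebra2 => _ [i _ [A mA <-]].
  exists (dfwith (fun j => [set: event_poset (G j)]) i A).
    by move=> j; case: dfwithP.
  apply/seteqP; split=> [x [_ Ax] j|x /(_ i)]; last by rewrite dfwithin.
  by case: dfwithP.
apply: smallest_sub; first exact: sigma_algebra_measurable.
by move=> _ [E mE ->]; exact: measurable_box.
Qed.

Lemma measure_eq_on_boxes (m1 m2 : {measure set (prod_poset G) -> \bar R}) :
  m1 setT < +oo ->
  (forall E : forall i : 'I_n, set (event_poset (G i)),
     (forall i, measurable (E i)) -> m1 (box E) = m2 (box E)) ->
  forall A, measurable A -> m1 A = m2 A.
Proof.
move=> fin eqbox.
apply: (measure_unique _ (fun=> setT) measurable_generated_by_boxes).
- move=> _ _ [E mE ->] [F mF ->]; exists (fun i => E i `&` F i).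
    by move=> i; exact: measurableI.
  apply/seteqP; split=> [x [Ex Fx] i|x EFx]; first by split.
  by split=> i; have [] := EFx i.
- move=> _; exists (fun=> setT) => //.
  by apply/seteqP; split.
- exact: bigcup_const.
- by move=> _ [E mE ->]; exact: eqbox.
- by [].
Qed.

Lemma resample_box (i : 'I_n) (E : forall i : 'I_n, set (event_poset (G i))) :
  resample i @^-1` (box E) = box (dfwith E i setT) `*` E i.
Proof.
apply/seteqP; split=> [[x t]/= Et|[x t]/= [Ex Et]].
  split; last by have := Et i; rewrite /resample dfwithin.
  move=> j; case: dfwithP => // k ik.
  by have := Et k; rewrite /resample dfwithout.
move=> j; rewrite /resample/=; case: dfwithP => // k ik.
by have := Ex k; rewrite dfwithout.
Qed.

(** The preimage of a box under [resample i] is the product of the box with its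
    i-th side dropped and of that side, so both measures agree on boxes. *)
Lemma resample_preserves (i : 'I_n) (A : set (prod_poset G)) :
  measurable A -> (P \x mu i) (resample i @^-1` A) = P A.
Proof.
move=> mA.
pose nu : {measure set (prod_poset G) -> \bar R} :=
  measure_function_pushforward__canonical__measure_function_Measure
    (P \x mu i) (measurable_resample i).
have setT_resampled E (j : 'I_n) : (forall i, measurable (E i)) ->
    measurable (dfwith E i [set: event_poset (G i)] j).
  by move=> mE; case: dfwithP.
apply/esym; apply: (@measure_eq_on_boxes P nu _ _ A mA).
  exact: (le_lt_trans (probability_le1 P measurableT) (ltry _)).
move=> E mE; rewrite /nu/= /pushforward resample_box.
rewrite product_measure1E//; last first.
  by apply: measurable_box => j; exact: setT_resampled.
have PE := probability_box _ (fun j => setT_resampled E j mE).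
rewrite (probability_box _ mE) (bigD1 i)//= muleC.
apply/esym; apply: (etrans (congr1 (fun y => y * mu i (E i)) PE)).
rewrite (bigD1 i)//= dfwithin (probability_setT (mu i)) mul1e.
congr (_ * _).
by apply: eq_bigr => j ji; rewrite dfwithout// eq_sym.
Qed.

(** The conditional expectation of f given all coordinates but the i-th, as a
    function on the whole product that does not depend on coordinate i. *)
Definition average (i : 'I_n) (f : prod_poset G -> R) (x : prod_poset G) : R :=
  (\int[mu i]_t f (resample i (x, t)))%R.

Lemma measurable_section (i : 'I_n) (f : prod_poset G -> R)
    (x : prod_poset G) :
  measurable_fun setT f -> measurable_fun setT (fun t => f (resample i (x, t))).
Proof.
move=> mf; apply: (measurableT_comp mf).
apply: (measurableT_comp (measurable_resample i)).
exact: pair1_measurable.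
Qed.

Lemma average_EFin (i : 'I_n) (f : prod_poset G -> R) (c : R)
    (x : prod_poset G) :
  measurable_fun setT f -> (forall x, 0 <= f x <= c)%R ->
  (average i f x)%:E = fubini_F (mu i) (EFin \o f \o resample i) x.
Proof.
move=> mf fc; rewrite /average /Rintegral fineK//.
apply: integrable_fin_num => //.
apply: (probability_bounded_integrable _ _ _ _ _ c) => //.
exact: measurable_section.
Qed.

Lemma measurable_average (i : 'I_n) (f : prod_poset G -> R) (c : R) :
  measurable_fun setT f -> (forall x, 0 <= f x <= c)%R ->
  measurable_fun setT (average i f).
Proof.
move=> mf fc; apply/measurable_EFinP.
rewrite (_ : _ \o _ = fubini_F (mu i) (EFin \o f \o resample i)).
  apply: measurable_fun_fubini_tonelli_F.
    apply: measurableT_comp (measurable_resample i).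
    exact/measurable_EFinP.
  by move=> z; rewrite lee_fin; case/andP: (fc (resample i z)).
by apply/funext => x; exact: average_EFin fc.
Qed.

Lemma Rintegral_average (i : 'I_n) (f : prod_poset G -> R) (c : R) :
  measurable_fun setT f -> (forall x, 0 <= f x <= c)%R ->
  (\int[P]_x f x = \int[P]_x average i f x)%R.
Proof.
move=> mf fc; congr fine.
under [RHS]eq_integral do rewrite (average_EFin _ _ _ _ mf fc).
have mEf : measurable_fun setT (EFin \o f) by exact/measurable_EFinP.
rewrite -fubini_tonelli1; first last.
- by move=> z; rewrite lee_fin; case/andP: (fc (resample i z)).
- by apply: measurableT_comp (measurable_resample i).
rewrite -[RHS](ge0_integral_pushforward (measurable_resample i) _
  measurableT mEf).
  apply: eq_measure_integral; first exact: measurable_resample.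
  by move=> mr A mA _; exact: (esym (resample_preserves i A mA)).
by move=> x _; rewrite lee_fin; case/andP: (fc x).
Qed.

(** * Averaging out all coordinates *)

Definition increasing_weight (f : prod_poset G -> R) : Prop :=
  [/\ measurable_fun setT f, forall x, (0 <= f x <= 1)%R
    & forall x y : prod_poset G, (x <= y)%O -> (f x <= f y)%R].

Lemma resample_le (i : 'I_n) (x y : prod_poset G) (t u : event_poset (G i)) :
  (x <= y)%O -> (t <= u)%O -> (resample i (x, t) <= resample i (y, u))%O.
Proof.
move=> /forallP xy tu; apply/forallP => j; rewrite /resample/=.
have [ij|ij] := eqVneq i j; first by subst j; rewrite !dfwithin.
by rewrite !dfwithout//; exact: xy.
Qed.

Lemma integrable_section (i : 'I_n) (f : prod_poset G -> R)
    (x : prod_poset G) :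
  increasing_weight f ->
  (mu i).-integrable setT (EFin \o (fun t => f (resample i (x, t)))).
Proof.
move=> [mf f01 _]; apply: (probability_bounded_integrable _ _ _ _ _ 1).
  exact: measurable_section.
by move=> t; exact: f01.
Qed.

Lemma average_increasing_weight (i : 'I_n) (f : prod_poset G -> R) :
  increasing_weight f -> increasing_weight (average i f).
Proof.
move=> wf; have [mf f01 fle] := wf; split.
- exact: measurable_average f01.
- move=> x; rewrite /average Rintegral_ge0/=; last first.
    by move=> t _; case/andP: (f01 (resample i (x, t))).
  rewrite -[leRHS](Rintegral_probability_cst _ _ _ (mu i)).
  apply: le_Rintegral => //; first exact: integrable_section.
    exact: finite_measure_integrable_cst.
  by move=> t _; case/andP: (f01 (resample i (x, t))).
- move=> x y xy; apply: le_Rintegral => //; try exact: integrable_section.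
  by move=> t _; apply: fle; exact: resample_le.
Qed.

Variables (p : R) (M : nat).
Hypothesis p01 : (0 < p < 1)%R.
Hypothesis Mp : (1 <= M%:R * p)%R.
Hypothesis top_atom : forall i : 'I_n,
  measurable [set (\top : event_poset (G i))%O] /\
  p%:E <= mu i [set (\top : event_poset (G i))%O].

Lemma increasing_weight_exprM (f g : prod_poset G -> R) :
  increasing_weight f -> increasing_weight g ->
  measurable_fun setT (fun x => (f x * g x) ^+ M.+1)%R /\
  (forall x, 0 <= (f x * g x) ^+ M.+1 <= 1)%R.
Proof.
move=> [mf f01 _] [mg g01 _]; split; first exact: measurable_expM.
move=> x; have /andP[fx fx1] := f01 x; have /andP[gx gx1] := g01 x.
by rewrite exprn_ge0 ?exprn_ile1 ?mulr_ge0 ?mulr_ile1.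
Qed.

(** The tensorization step: [atom_correlation] in coordinate i, with the others
    fixed. Its maximality hypothesis holds at the greatest element of the i-th
    factor because f and g are increasing. *)
Lemma le_Rintegral_average_exprM (i : 'I_n) (f g : prod_poset G -> R) :
  increasing_weight f -> increasing_weight g ->
  (\int[P]_x (average i f x * average i g x) ^+ M.+1 <=
   \int[P]_x (f x * g x) ^+ M.+1)%R.
Proof.
move=> wf wg; have [mH H01] := increasing_weight_exprM _ _ wf wg.
rewrite [leRHS](Rintegral_average i _ _ mH H01).
have [mA A01] := increasing_weight_exprM _ _
  (average_increasing_weight i _ wf) (average_increasing_weight i _ wg).
apply: le_Rintegral => //.
- exact: probability_bounded_integrable A01.
- apply: (probability_bounded_integrable _ _ _ _ _ 1).
    exact: measurable_average H01.
  move=> x; rewrite /average Rintegral_ge0/=; last first.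
    by move=> t _; case/andP: (H01 (resample i (x, t))).
  rewrite -[leRHS](Rintegral_probability_cst _ _ _ (mu i)).
  apply: le_Rintegral => //.
  + apply: (probability_bounded_integrable _ _ _ _ _ 1) => //.
    exact: (measurable_section i _ x mH).
  + exact: finite_measure_integrable_cst.
  + by move=> t _; case/andP: (H01 (resample i (x, t))).
- move=> x _; have [mtop ptop] := top_atom i.
  have [mf f01 fle] := wf; have [mg g01 gle] := wg.
  apply: (@atom_correlation _ _ _ (mu i) _ p M _ _ p01 Mp mtop ptop).
  + exact: measurable_section.
  + exact: measurable_section.
  + move=> t; have /andP[-> _]/= := f01 (resample i (x, t)).
    by apply: fle; apply: resample_le => //; exact: lex1.
  + move=> t; have /andP[-> _]/= := g01 (resample i (x, t)).
    by apply: gle; apply: resample_le => //; exact: lex1.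
Qed.

Definition averages (s : seq 'I_n) (f : prod_poset G -> R) :=
  foldr average f s.

Lemma averages_increasing_weight (s : seq 'I_n) (f : prod_poset G -> R) :
  increasing_weight f -> increasing_weight (averages s f).
Proof. by move=> wf; elim: s => //= i s; exact: average_increasing_weight. Qed.

Lemma Rintegral_averages (s : seq 'I_n) (f : prod_poset G -> R) :
  increasing_weight f -> (\int[P]_x averages s f x = \int[P]_x f x)%R.
Proof.
move=> wf; elim: s => //= i s <-.
have [mf f01 _] := averages_increasing_weight s f wf.
by rewrite [RHS](Rintegral_average i _ _ mf f01).
Qed.

Lemma le_Rintegral_averages_exprM (s : seq 'I_n) (f g : prod_poset G -> R) :
  increasing_weight f -> increasing_weight g ->
  (\int[P]_x (averages s f x * averages s g x) ^+ M.+1 <=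
   \int[P]_x (f x * g x) ^+ M.+1)%R.
Proof.
move=> wf wg; elim: s => //= i s; apply: le_trans.
by apply: le_Rintegral_average_exprM; exact: averages_increasing_weight.
Qed.

Lemma averages_eq_off (s : seq 'I_n) (f : prod_poset G -> R)
    (x y : prod_poset G) :
  (forall j, j \notin s -> x j = y j) -> averages s f x = averages s f y.
Proof.
elim: s x y => [|i s IHs] x y xy /=.
  by congr f; apply: functional_extensionality_dep => j; exact: xy.
apply: eq_Rintegral => t _; apply: IHs => j js; rewrite /resample/=.
have [ij|ij] := eqVneq i j; first by subst j; rewrite !dfwithin.
by rewrite !dfwithout//; apply: xy; rewrite in_cons negb_or eq_sym ij.
Qed.

(** By [averages_eq_off] the average over all coordinates takes one value, which
    is its integral. *)
Lemma averages_cst (f : prod_poset G -> R) :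
  increasing_weight f ->
  averages (enum 'I_n) f = (fun=> \int[P]_x f x)%R.
Proof.
move=> wf; apply/funext => x.
rewrite -(Rintegral_averages (enum 'I_n) f wf).
rewrite -[LHS](Rintegral_probability_cst _ _ _ P); apply: eq_Rintegral => y _.
by apply: averages_eq_off => j; rewrite mem_enum.
Qed.

(** The functional form of the theorem, for the product measure. *)
Lemma increasing_weight_correlation (f g : prod_poset G -> R) :
  increasing_weight f -> increasing_weight g ->
  ((\int[P]_x f x * \int[P]_x g x) ^+ M.+1 <=
   \int[P]_x (f x * g x) ^+ M.+1)%R.
Proof.
move=> wf wg.
apply: le_trans (le_Rintegral_averages_exprM (enum 'I_n) f g wf wg).
by rewrite !averages_cst// Rintegral_probability_cst.
Qed.

Lemma upset_increasing_weight (A : set (prod_poset G)) :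
  measurable A -> upset A -> increasing_weight \1_A.
Proof.
move=> mA uA; split; first exact: measurable_indic.
  by move=> x; rewrite indicE; case: (_ \in _); rewrite /= ?lexx ?ler01.
move=> x y xy; rewrite !indicE ler_nat.
have [|//] := boolP (x \in A); rewrite inE => Ax.
by rewrite mem_set//; exact: uA xy.
Qed.

Lemma upset_correlation (A B : set (prod_poset G)) :
  measurable A -> measurable B -> upset A -> upset B ->
  (P A * P B) `^ M.+1%:R <= P (A `&` B).
Proof.
move=> mA mB uA uB.
have Pfin (D : set (prod_poset G)) : measurable D ->
    P D = (\int[P]_x \1_D x)%:E.
  move=> mD; rewrite /Rintegral integral_indic// setIT fineK//.
  exact: fin_num_measure.
have mAB : measurable (A `&` B) by exact: measurableI.
rewrite !Pfin// -EFinM poweR_EFin lee_fin powR_mulrn; last first.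
  by rewrite mulr_ge0// Rintegral_ge0.
apply: le_trans (increasing_weight_correlation _ _
  (upset_increasing_weight _ mA uA) (upset_increasing_weight _ mB uB)) _.
rewrite le_eqVlt; apply/orP; left; apply/eqP; apply: eq_Rintegral => x _.
rewrite indicI/= !indicE.
by do 2!case: (_ \in _); rewrite /= ?mulr0 ?mul0r ?mulr1 ?expr0n ?expr1n.
Qed.

End resampling.

Theorem lemma3p1 (R : realType) (p : R) (hp : (0 < p)%R) :
  exists2 C : R, (0 < C)%R &
  forall (n : nat) (o : 'I_n -> Order.disp_t)
    (T : forall i : 'I_n, tPOrderType (o i))
    (G : forall i : 'I_n, set (set (T i)))
    (mu : forall i : 'I_n, probability (event_poset (G i)) R)
    (P : probability (prod_poset G) R),
  is_product_probability mu P ->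
  (forall i : 'I_n, measurable [set (\top : event_poset (G i))%O] /\
                    p%:E <= mu i [set (\top : event_poset (G i))%O]) ->
  forall A B : set (prod_poset G),
  measurable A -> measurable B -> upset A -> upset B ->
  (P A * P B) `^ C <= P (A `&` B).
Proof.
(* The scalar inequality needs p < 1; lowering p only weakens the hypothesis on
   the greatest elements. *)
pose q := Num.min p (1 / 2)%R.
have q0 : (0 < q)%R by rewrite lt_min hp/=; lra.
have q1 : (q < 1)%R by rewrite gt_min; apply/orP; right; lra.
pose M := Num.bound q^-1%R.
have Mq : (1 <= M%:R * q)%R.
  by rewrite -ler_pdivrMr// mul1r ltW// archi_boundP// invr_ge0 ltW.
exists M.+1%:R => // n o T G mu P muP top_atom A B mA mB uA uB.
apply: (@upset_correlation _ _ _ _ _ mu P muP q M _ Mq) => //.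
  by rewrite q0.
move=> i; have [mtop ptop] := top_atom i; split=> //.
by apply: le_trans ptop; rewrite lee_fin ge_min lexx.
Qed.
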